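(* Let $L_w^p$ be an arbitrary label (as defined in the context) associated with driver $w$ and bundle $b^p=(i_1,\dots,i_\ell)$, with $R^p\neq\emptyset$, to which at most $k_{\max}$ tasks can be added. Let $c^{\max}=\max_{t\in R^p}c_t$, $\pi^{\min}=\min_{t\in R^p}\pi_t$, $\pi^p=\sum_{i\in b^p}\pi_i$, and for $i\in\{1,\dots,n\}$ let $U_i^{\max}$ and $U_i^{\min}$ be the maximum and minimum of $\mathcal U_i(s,t)$ over $s\in\{\mathcal T^p\}\cup R^p$, $t\in R^p$. For each $k\in\{1,\dots,k_{\max}\}$ let $\hat X^k\in\mathbb R^n_+$, $\hat C^k\ge0$, $\hat\pi^k\ge0$ satisfy $\hat X_i^k=X_i^p+kU_i^{\max}$ for all $i$ with $B_i^w>0$, $\hat X_i^k=X_i^p+kU_i^{\min}$ for all $i$ with $B_i^w<0$, $\hat C^k=\bar C^p+kc^{\max}$, and $\hat\pi^k=\pi^p+k\pi^{\min}$, and let $$\hat c^k=\frac{W\!\left(e^{\alpha^w+B^w\hat X^k+D^wY_w+\gamma^w\hat C^k-1}\right)}{\gamma^w}-\hat\pi^k-\mu_w.$$ If $\hat c^k\le 0$ for every $k\in\{1,\dots,k_{\max}\}$, then no extension of $L_w^p$ can correspond to a variable with positive reduced cost, i.e. every label $L_w^f$ obtained from $L_w^p$ by one or more extensions satisfies $\tilde c^f\le 0$.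
   Context: Data. $M$ (tasks) and $D$ (depots) are finite sets; task $i$ has load $q_i\ge 0$ and third-party cost $c_i\ge 0$; $T(d)\subseteq M$ is the set of tasks deliverable from depot $d$; driver $w$ has capacity $Q^w$. Acceptance parameters of $w$: $\alpha^w\in\mathbb R$, $B^w=(B^w_1,\dots,B^w_n)\in\mathbb R^n$, $D^w\in\mathbb R^m$, $Y_w\in\mathbb R^m$, $\gamma^w>0$. Dual values $\pi_i\ge 0$ ($i\in M$), $\mu_w\ge 0$. Products of vectors are dot products. For each $i\in\{1,\dots,n\}$ an update function $\mathcal U_i:(M\cup D)\times M\to\mathbb R_{\ge 0}$ is given. $W$ is the principal real branch of the Lambert function: for $\phi>0$, $W(\phi)$ is the unique $\eta>0$ with $\eta e^\eta=\phi$. Labels. A label $L_w^p$ of $w$ carries: a bundle $b^p$ (tuple of distinct tasks), a pick-up depot $d^p$, the used capacity $q^p=\sum_{i\in b^p}q_i$, predictor values $X^p\in\mathbb R^n_{\ge0}$, $\bar C^p=\sum_{i\in b^p}c_i$, a set $R^p\subseteq T(d^p)$ of reachable tasks, and the reduced cost $\tilde c^p$. $\mathcal T^p$ is the last task of $b^p$ if $b^p\neq\emptyset$, and $\mathcal T^p=d^p$ otherwise. Labels are exactly those obtained from initial labels by finitely many extensions: - Initial labels: for each $d\in D$, the label with $b^p=\emptyset$, $d^p=d$, $q^p=0$, $X^p=\bar X^p$ (a given vector of nonnegative initial values), $\bar C^p=0$, $R^p=T(d)$, $\tilde c^p=-\mu_w$. - Extension of $L^p_w$ by a task $t\in R^p$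 yields $L_w^f$ with $b^f$ equal to $b^p$ with $t$ appended, $d^f=d^p$, $q^f=q^p+q_t$, $X_i^f=X_i^p+\mathcal U_i(\mathcal T^p,t)$ for $i=1,\dots,n$, $\bar C^f=\bar C^p+c_t$, and $R^f=R^p\setminus(\{t\}\cup\{i\in R^p:q^f+q_i>Q^w\})$. The reduced cost of a label $L_w^g$ (the reduced cost of the variable representing the offer of its bundle to $w$) is $\tilde c^g=\max_{C\ge 0}\dfrac{\bar C^g-C}{1+e^{-(\alpha^w+B^wX^g+D^wY_w+\gamma^wC)}}-\sum_{i\in b^g}\pi_i-\mu_w$. ''At most $k_{\max}$ tasks can be added to $L_w^p$'' means that any sequence of successive extensions starting from $L_w^p$ has length at most $k_{\max}$. *)

(* Defs.v *)
From HB Require Import structures.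
From mathcomp Require Import all_boot all_order all_algebra.
From mathcomp Require Import all_classical all_reals all_analysis.
Set Implicit Arguments.
Unset Strict Implicit.
Unset Printing Implicit Defensive.
Import Order.TTheory GRing.Theory Num.Theory.
Import numFieldNormedType.Exports.
Local Open Scope classical_set_scope.
Local Open Scope ring_scope.

Definition is_maximum (R : realType) (A : set R) (v : R) : Prop :=
  A v /\ ubound A v.

Definition is_minimum (R : realType) (A : set R) (v : R) : Prop :=
  A v /\ lbound A v.

Definition dot (R : realType) (n : nat) (u v : 'rV[R]_n) : R :=
  \sum_(i < n) u 0 i * v 0 i.

(* Only meaningful for [0 < phi]; see [lambertW_spec], [lambertW_unique]. *)
Definition lambertW (R : realType) (phi : R) : R :=
  xget 0 [set eta : R | 0 < eta /\ eta * expR eta = phi].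

(* The sum type [M + Dep] plays the role of the union of tasks and depots. *)
Record instance (R : realType) (M Dep : finType) (n : nat) := Instance {
  load : M -> R;
  third_party_cost : M -> R;
  deliverable : Dep -> {set M};
  update : 'I_n -> M + Dep -> M -> R;
  initial_predictors : Dep -> 'rV[R]_n;
  task_dual : M -> R;
  load_ge0 : forall i, 0 <= load i;
  third_party_cost_ge0 : forall i, 0 <= third_party_cost i;
  update_ge0 : forall i s t, 0 <= update i s t;
  initial_predictors_ge0 : forall d i, 0 <= initial_predictors d 0 i;
  task_dual_ge0 : forall i, 0 <= task_dual i
}.

(* [alpha], [bundle_coef], [driver_coef], [driver_attr], [gamma] and
   [driver_dual] are alpha^w, B^w, D^w, Y_w, gamma^w and mu_w. *)
Record driver (R : realType) (n m : nat) := Driver {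
  capacity : R;
  alpha : R;
  bundle_coef : 'rV[R]_n;
  driver_coef : 'rV[R]_m;
  driver_attr : 'rV[R]_m;
  gamma : R;
  driver_dual : R;
  gamma_gt0 : 0 < gamma;
  driver_dual_ge0 : 0 <= driver_dual
}.

(* For labels satisfying [is_label] the bundle is duplicate-free, because an
   appended task leaves the reachable set. *)
Record label (R : realType) (M Dep : finType) (n : nat) := Label {
  bundle : seq M;
  depot : Dep;
  used : R;
  predictors : 'rV[R]_n;
  bundle_cost : R;
  reachable : {set M};
  reduced_cost : R
}.

Definition last_stop (R : realType) (M Dep : finType) (n : nat)
    (L : label R M Dep n) : M + Dep :=
  last (inr (depot L)) [seq inl i | i <- bundle L].

Definition utility (R : realType) (n m : nat) (w : driver R n m)
    (X : 'rV[R]_n) (C : R) : R :=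
  alpha w + dot (bundle_coef w) X + dot (driver_coef w) (driver_attr w)
  + gamma w * C.

Definition expected_saving (R : realType) (n m : nat) (w : driver R n m)
    (X : 'rV[R]_n) (Cbar C : R) : R :=
  (Cbar - C) / (1 + expR (- utility w X C)).

Definition has_reduced_cost (R : realType) (M Dep : finType) (n m : nat)
    (I : instance R M Dep n) (w : driver R n m) (L : label R M Dep n) : Prop :=
  exists2 v : R,
    is_maximum
      (expected_saving w (predictors L) (bundle_cost L) @` [set C | 0 <= C]) v
    & reduced_cost L = v - \sum_(i <- bundle L) task_dual I i - driver_dual w.

Definition initial_label (R : realType) (M Dep : finType) (n m : nat)
    (I : instance R M Dep n) (w : driver R n m) (d : Dep) : label R M Dep n :=
  {| bundle := [::];
     depot := d;
     used := 0;
     predictors := initial_predictors I d;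
     bundle_cost := 0;
     reachable := deliverable I d;
     reduced_cost := - driver_dual w |}.

Record extension (R : realType) (M Dep : finType) (n m : nat)
    (I : instance R M Dep n) (w : driver R n m)
    (Lp : label R M Dep n) (t : M) (Lf : label R M Dep n) : Prop := Extension {
  ext_reachable : t \in reachable Lp;
  ext_bundle : bundle Lf = rcons (bundle Lp) t;
  ext_depot : depot Lf = depot Lp;
  ext_used : used Lf = used Lp + load I t;
  ext_predictors : forall i : 'I_n,
    predictors Lf 0 i = predictors Lp 0 i + update I i (last_stop Lp) t;
  ext_bundle_cost : bundle_cost Lf = bundle_cost Lp + third_party_cost I t;
  ext_reachable_set : forall i : M,
    (i \in reachable Lf) =
    [&& i \in reachable Lp, i != t & ~~ (capacity w < used Lf + load I i)];
  ext_reduced_cost : has_reduced_cost I w Lf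
}.

(* [extends I w k L L']: [L'] arises from [L] by [k] successive extensions. *)
Inductive extends (R : realType) (M Dep : finType) (n m : nat)
    (I : instance R M Dep n) (w : driver R n m) :
    nat -> label R M Dep n -> label R M Dep n -> Prop :=
| extends0 L : extends I w 0 L L
| extendsS k L L' L'' t :
    extends I w k L L' -> extension I w L' t L'' -> extends I w k.+1 L L''.

Definition is_label (R : realType) (M Dep : finType) (n m : nat)
    (I : instance R M Dep n) (w : driver R n m) (L : label R M Dep n) : Prop :=
  exists d k, extends I w k (initial_label I w d) L.

Definition at_most_extensions (R : realType) (M Dep : finType) (n m : nat)
    (I : instance R M Dep n) (w : driver R n m) (L : label R M Dep n)
    (kmax : nat) : Prop :=
  forall k L', extends I w k L L' -> (k <= kmax)%N.

Lemma lambertW_inj (R : realType) (x y : R) :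
  0 < x -> 0 < y -> x * expR x = y * expR y -> x = y.
Proof.
suff lt_mono (a b : R) : 0 < a -> a < b -> a * expR a < b * expR b.
  move=> x0 y0 xy; case: (ltgtP x y) => // h.
  - by have := lt_mono _ _ x0 h; rewrite xy ltxx.
  - by have := lt_mono _ _ y0 h; rewrite xy ltxx.
by move=> a0 ab; rewrite ltr_pM ?ltr_expR ?expR_ge0 ?(ltW a0).
Qed.

Lemma lambertW_spec (R : realType) (phi : R) : 0 < phi ->
  0 < lambertW phi /\ lambertW phi * expR (lambertW phi) = phi.
Proof.
move=> phi0.
suff /(xgetPex 0) : exists x : R, 0 < x /\ x * expR x = phi by [].
have [||c] := @IVT R (fun x => x * expR x) 0 phi phi (ltW phi0).
- apply: continuous_subspaceT => x; apply: cvgM; first exact: cvg_id.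
  exact: continuous_expR.
- have le1 : phi <= phi * expR phi.
    by rewrite ler_peMr ?(ltW phi0)// leNgt expR_lt1 -leNgt ltW.
  rewrite mul0r ge_min le_max le1 (ltW phi0) orbT //.
rewrite in_itv/= => /andP[c0 _] Hc; exists c; split=> //.
rewrite lt_neqAle c0 andbT; apply/eqP => c0'.
by move: Hc phi0; rewrite -c0' mul0r => <-; rewrite ltxx.
Qed.

Lemma lambertW_unique (R : realType) (phi eta : R) :
  0 < eta -> eta * expR eta = phi -> lambertW phi = eta.
Proof.
move=> eta0 H; have phi0 : 0 < phi by rewrite -H mulr_gt0 ?expR_gt0.
have [W0 HW] := lambertW_spec phi0.
by apply: lambertW_inj => //; rewrite HW.
Qed.

Lemma expected_saving_max (R : realType) (n m : nat) (w : driver R n m)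
    (X : 'rV[R]_n) (Cbar : R) : 0 <= Cbar ->
  exists v, is_maximum (expected_saving w X Cbar @` [set C | 0 <= C]) v.
Proof.
move=> Cbar0.
have den0 C : 0 < 1 + expR (- utility w X C).
  by rewrite addr_gt0 ?expR_gt0.
have cnt : continuous (expected_saving w X Cbar).
  move=> C; apply: cvgM; first by apply: cvgB; [exact: cvg_cst|exact: cvg_id].
  apply: cvgV; first by rewrite gt_eqF.
  apply: cvgD; first exact: cvg_cst.
  apply: (@continuous_comp _ _ _ (fun C => - utility w X C) expR);
    last exact: continuous_expR.
  apply: cvgN; apply: cvgD; first exact: cvg_cst.
  by apply: cvgM; [exact: cvg_cst|exact: cvg_id].
have [c cI cmax] := @EVT_max R _ 0 Cbar Cbar0 (continuous_subspaceT cnt).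
exists (expected_saving w X Cbar c); split.
  by exists c => //=; move: cI; rewrite in_itv/= => /andP[].
move=> _ [C /= C0 <-]; have [CC|CC] := leP C Cbar.
  by apply: cmax; rewrite in_itv/= C0.
apply: (@le_trans _ _ (expected_saving w X Cbar Cbar)).
  rewrite /expected_saving subrr mul0r; apply: mulr_le0_ge0.
    by rewrite subr_le0 ltW.
  by apply: ltW; rewrite invr_gt0.
by apply: cmax; rewrite in_itv/= Cbar0 lexx.
Qed.

(* Main.v *)
Require Import Defs.
From HB Require Import structures.
From mathcomp Require Import all_boot all_order all_algebra.
From mathcomp Require Import all_classical all_reals all_analysis.
From mathcomp Require Import ring lra.
Import Order.TTheory GRing.Theory Num.Theory.
Local Open Scope classical_set_scope.
Local Open Scope ring_scope.

(** For any compensation [C], put [x := gamma * (Cbar - C)] and let [u] bound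
    the utility at [C = Cbar] from above.  With [eta := W (exp (u - 1))], i.e.
    [eta * exp eta = exp (u - 1)], the inequality [1 + y <= exp y] at
    [y := x - 1 - eta] gives
    [x <= eta + exp (x - 1 - eta) = eta * (1 + exp (x - u))],
    so the expected saving never exceeds [eta / gamma].  After [k] extensions,
    the cost, the predictors weighted by [B^w] and the duals are controlled by
    the [k]-step estimates, so this bound applies with their utility for [u]. *)

Lemma expected_saving_le (R : realType) (n m : nat) (w : driver R n m)
    (X : 'rV[R]_n) (Cbar C u : R) :
  utility w X Cbar <= u ->
  expected_saving w X Cbar C <= lambertW (expR (u - 1)) / gamma w.
Proof.
move=> leu; have g0 := gamma_gt0 w.
have [eta0 etaE] := lambertW_spec (expR_gt0 (u - 1)).
set eta := lambertW _ in eta0 etaE *.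
rewrite /expected_saving ler_pdivrMr ?addr_gt0 ?expR_gt0//.
rewrite mulrAC ler_pdivlMr//.
set x := (Cbar - C) * gamma w.
have xE : utility w X C = utility w X Cbar - x by rewrite /utility /x; ring.
have eta_exp : eta * expR (x - u) = expR (x - 1 - eta).
  (* Multiplying by [expR eta] brings in the defining equation of [eta]; both sides become
     [expR (x - 1)]. *)
  apply: (mulIf (lt0r_neq0 (expR_gt0 eta))).
  by rewrite mulrAC etaE -!expRD; congr expR; ring.
rewrite mulrDr mulr1.
have le_exp : eta * expR (x - u) <= eta * expR (- utility w X C).
  by rewrite ler_pM2l// ler_expR xE; lra.
have := expR_ge1Dx (x - 1 - eta); rewrite -eta_exp; lra.
Qed.

Section Extends.
Set Implicit Arguments.
Unset Strict Implicit.
Variables (R : realType) (M Dep : finType) (n m : nat).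
Variables (I : instance R M Dep n) (w : driver R n m).
Implicit Types (L Lp Lf : label R M Dep n) (k : nat) (c : R).

Lemma last_stop_extension Lp t Lf :
  extension I w Lp t Lf -> last_stop Lf = inl t.
Proof. by move=> E; rewrite /last_stop (ext_bundle E) map_rcons last_rcons. Qed.

(** Needed so that extrema over [reachable Lp] also bound every task appended later. *)
Lemma extends_reachable k Lp Lf :
  extends I w k Lp Lf -> reachable Lf \subset reachable Lp.
Proof.
elim=> // {}k L L' L'' t _ IH E; apply: fintype.subset_trans IH.
by apply/fintype.subsetP => i; rewrite (ext_reachable_set E) => /and3P[].
Qed.

(** The two cases are exactly the range of [s] in the extrema of [update]: before any extension the
    last stop may be the depot or a task already served, afterwards it is a task taken from
    [reachable Lp]. *)
Lemma extends_last_stop k Lp Lf : extends I w k Lp Lf ->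
  last_stop Lf = last_stop Lp \/
  exists2 j, j \in reachable Lp & last_stop Lf = inl j.
Proof.
case=> [L|{}k L L' L'' t LL' E]; [by left|right].
exists t; last exact: last_stop_extension E.
exact: (fintype.subsetP (extends_reachable LL')) (ext_reachable E).
Qed.

Lemma extends_bundle_cost_le k Lp Lf c : extends I w k Lp Lf ->
  (forall t, t \in reachable Lp -> third_party_cost I t <= c) ->
  bundle_cost Lf <= bundle_cost Lp + k%:R * c.
Proof.
elim=> [L _|{}k L L' L'' t LL' IH E ub]; first by rewrite mul0r addr0.
rewrite (ext_bundle_cost E) -natr1 mulrDl mul1r addrA lerD ?IH// ub//.
exact: (fintype.subsetP (extends_reachable LL')) (ext_reachable E).
Qed.

Lemma extends_task_dual_ge k Lp Lf c : extends I w k Lp Lf ->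
  (forall t, t \in reachable Lp -> c <= task_dual I t) ->
  \sum_(i <- bundle Lp) task_dual I i + k%:R * c
    <= \sum_(i <- bundle Lf) task_dual I i.
Proof.
elim=> [L _|{}k L L' L'' t LL' IH E lb]; first by rewrite mul0r addr0.
rewrite (ext_bundle E) big_rcons/= -natr1 mulrDl mul1r addrA lerD ?IH// lb//.
exact: (fintype.subsetP (extends_reachable LL')) (ext_reachable E).
Qed.

(** Both sides are kept because the sign of the coefficient in [B^w] decides which one bounds the
    utility from above. *)
Lemma extends_predictors_bound k Lp Lf (i : 'I_n) (lo hi : R) :
  extends I w k Lp Lf ->
  (forall s t,
     s = last_stop Lp \/ (exists2 j, j \in reachable Lp & s = inl j) ->
     t \in reachable Lp -> lo <= update I i s t <= hi) ->
  predictors Lp 0 i + k%:R * lo <= predictors Lf 0 i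
    <= predictors Lp 0 i + k%:R * hi.
Proof.
elim=> [L _|{}k L L' L'' t LL' IH E bnd]; first by rewrite !mul0r !addr0 lexx.
have /andP[IHlo IHhi] := IH bnd.
have tL := fintype.subsetP (extends_reachable LL') _ (ext_reachable E).
have /andP[lo_t hi_t] := bnd _ _ (extends_last_stop LL') tL.
by rewrite (ext_predictors E) -natr1 !mulrDl !mul1r !addrA !lerD.
Qed.

End Extends.

Theorem corollary2 (R : realType) (M Dep : finType) (n m : nat)
  (I : instance R M Dep n) (w : driver R n m)
  (Lp : label R M Dep n) (kmax : nat)
  (cmax pimin : R) (Umax Umin : 'I_n -> R)
  (Xhat : nat -> 'rV[R]_n) (Chat pihat chat : nat -> R)
  (Lp_label : is_label I w Lp)
  (Lp_reachable : reachable Lp != finset.set0)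
  (Lp_kmax : at_most_extensions I w Lp kmax)
  (cmaxE : is_maximum
     [set x | exists2 t : M, t \in reachable Lp & x = third_party_cost I t]
     cmax)
  (piminE : is_minimum
     [set x | exists2 t : M, t \in reachable Lp & x = task_dual I t] pimin)
  (UmaxE : forall i : 'I_n, is_maximum
     [set x | exists (s : M + Dep) (t : M),
        [/\ s = last_stop Lp \/ (exists2 j, j \in reachable Lp & s = inl j),
            t \in reachable Lp & x = update I i s t]] (Umax i))
  (UminE : forall i : 'I_n, is_minimum
     [set x | exists (s : M + Dep) (t : M),
        [/\ s = last_stop Lp \/ (exists2 j, j \in reachable Lp & s = inl j),
            t \in reachable Lp & x = update I i s t]] (Umin i))
  (Xhat_ge0 : forall k, (1 <= k <= kmax)%N -> forall i, 0 <= Xhat k 0 i)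
  (Xhat_pos : forall k, (1 <= k <= kmax)%N -> forall i,
     0 < bundle_coef w 0 i -> Xhat k 0 i = predictors Lp 0 i + k%:R * Umax i)
  (Xhat_neg : forall k, (1 <= k <= kmax)%N -> forall i,
     bundle_coef w 0 i < 0 -> Xhat k 0 i = predictors Lp 0 i + k%:R * Umin i)
  (Chat_ge0 : forall k, (1 <= k <= kmax)%N -> 0 <= Chat k)
  (ChatE : forall k, (1 <= k <= kmax)%N ->
     Chat k = bundle_cost Lp + k%:R * cmax)
  (pihat_ge0 : forall k, (1 <= k <= kmax)%N -> 0 <= pihat k)
  (pihatE : forall k, (1 <= k <= kmax)%N ->
     pihat k = \sum_(i <- bundle Lp) task_dual I i + k%:R * pimin)
  (chatE : forall k, (1 <= k <= kmax)%N ->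
     chat k = lambertW (expR (alpha w + dot (bundle_coef w) (Xhat k)
                              + dot (driver_coef w) (driver_attr w)
                              + gamma w * Chat k - 1)) / gamma w
              - pihat k - driver_dual w)
  (chat_le0 : forall k, (1 <= k <= kmax)%N -> chat k <= 0) :
  forall (k : nat) (Lf : label R M Dep n),
    (1 <= k)%N -> extends I w k Lp Lf -> reduced_cost Lf <= 0.
Proof.
move=> k Lf k1 LpLf.
have kk : (1 <= k <= kmax)%N by rewrite k1 (Lp_kmax _ _ LpLf).
have cost_le : bundle_cost Lf <= Chat k.
  rewrite ChatE//; apply: extends_bundle_cost_le LpLf _ => t tR.
  by apply: cmaxE.2; exists t.
have dual_ge : pihat k <= \sum_(i <- bundle Lf) task_dual I i.
  rewrite pihatE//; apply: extends_task_dual_ge LpLf _ => t tR.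
  by apply: piminE.2; exists t.
have dot_le : dot (bundle_coef w) (predictors Lf)
              <= dot (bundle_coef w) (Xhat k).
  apply: ler_sum => i _.
  have /andP[ge_min le_max] : predictors Lp 0 i + k%:R * Umin i
      <= predictors Lf 0 i <= predictors Lp 0 i + k%:R * Umax i.
    apply: extends_predictors_bound LpLf _ => s t sL tR.
    by apply/andP; split; [apply: (UminE i).2 | apply: (UmaxE i).2];
       exists s, t.
  (* A negative coefficient reverses the order, so the lower estimate [Umin] enters there; for a
     zero coefficient both terms vanish. *)
  have [Bi|Bi|->] := ltgtP (bundle_coef w 0 i) 0; last by rewrite !mul0r.
  - by rewrite ler_nM2l// Xhat_neg.
  - by rewrite ler_pM2l// Xhat_pos.
(* As [1 <= k], the last step is an extension, which supplies the reduced cost. The maximum is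
   attained at some [C], so a bound valid for every compensation suffices. *)
have [v [[C _ <-] _] ->] : has_reduced_cost I w Lf.
  by case: LpLf k1 => // ? ? ? ? ? _ /ext_reduced_cost.
have := chat_le0 k kk; rewrite chatE//; apply: le_trans.
(* Comparing with [chat k] term by term leaves only the utility at [C = bundle_cost Lf], to be
   bounded by the estimated one. *)
rewrite !lerB ?lerD2r// expected_saving_le//.
have cost_gamma : gamma w * bundle_cost Lf <= gamma w * Chat k.
  by rewrite ler_pM2l ?gamma_gt0.
by rewrite /utility; lra.
Qed.
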